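(* Let $(\Omega,\mathcal A,\mu)$ be a $\sigma$-finite measure space and $K\in(0,\mu(\Omega))$. Let $X$ be a reflexive Banach space that is compactly embedded in $L^1(\Omega)$, let $f:X\to\overline{\mathbb R}$ be proper, lower semicontinuous, convex, bounded from below and coercive, and suppose there is $u_0\in X$ with $f(u_0)<\infty$ and $\|u_0\|_0\le K$. For $u\in X$ and $\rho>0$ put $P(u):=\|u\|_1-|u|_K$ and $f_\rho(u):=f(u)+\rho P(u)$. Let $(\rho_n)$ be a monotonically increasing sequence of positive numbers with $\lim_{n\to\infty}\rho_n=\infty$, and for every $n\in\mathbb N$ let $u_n$ be a global minimum of the penalized problem $\min_{u\in X}f_{\rho_n}(u)$. Then the sequence $(u_n)$ satisfies: (1) $f_{\rho_n}(u_n)\le f_{\rho_{n+1}}(u_{n+1})$ for all $n\in\mathbb N$; (2) $P(u_n)\ge P(u_{n+1})$ for all $n\in\mathbb N$; (3) $f(u_n)\le f(u_{n+1})$ for all $n\in\mathbb N$; (4) $\lim_{n\to\infty}P(u_n)=0$; (5) $(u_n)$ is bounded in $X$; (6) every weak accumulation point $\bar u$ of the sequence $(u_n)$ is a global solution of the problem $\min_{u\in X}f(u)$ subject to $\|u\|_0\le K$.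
   Context: $\|u\|_0:=\mu(\{x\in\Omega\mid u(x)\ne0\})$. The largest-$K$-norm is $|u|_K:=\sup_{A\in\mathcal A:\ \mu(A)\le K}\int_A|u|\,d\mu$; $\|u\|_1$ is the $L^1(\Omega)$-norm. $f$ is proper if $f>-\infty$ everywhere and $f(u)<\infty$ for some $u$; $f$ is coercive if $\|u_n\|_X\to\infty$ implies $f(u_n)\to\infty$ for every sequence $(u_n)\subseteq X$. A weak accumulation point of $(u_n)$ is the weak limit in $X$ of a subsequence.
   Formalization: The sequence (ρ_n) is taken to be strictly increasing; if ρ_n = ρ_{n+1} is allowed, claims (2) and (3) can fail because a penalized problem may have several global minima with different values of P and f. *)

(* Defs.v *)
From HB Require Import structures.
From mathcomp Require Import all_boot all_order all_algebra.
From mathcomp Require Import all_classical all_reals all_analysis.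
Set Implicit Arguments.
Unset Strict Implicit.
Unset Printing Implicit Defensive.
Import Order.TTheory GRing.Theory Num.Theory.
Import numFieldNormedType.Exports.
Local Open Scope classical_set_scope.
Local Open Scope ring_scope.

Section duality.
Context {R : realType} {X : normedModType R}.

Definition dual : set (X -> R^o) := [set phi | linear phi /\ continuous phi].

Definition dual_norm (phi : X -> R^o) : R :=
  sup [set `|phi x| | x in [set x : X | `|x| <= 1]].

(* Only the restriction of F to the dual space matters: F stands for an
   arbitrary map from the dual to the scalars. *)
Definition bidual : set ((X -> R^o) -> R) :=
  [set F | (forall (a : R) (phi psi : X -> R^o), dual phi -> dual psi ->
              F (fun x => a * phi x + psi x) = a * F phi + F psi) /\
           exists C : R, forall phi, dual phi -> `|F phi| <= C * dual_norm phi].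

Definition weak_cvg (w : nat -> X) (x : X) : Prop :=
  forall phi, dual phi -> phi (w n) @[n --> \oo] --> phi x.

Definition weak_accumulation_point (w : nat -> X) (x : X) : Prop :=
  exists2 k : nat -> nat, increasing_seq k & weak_cvg (w \o k) x.

End duality.

(* The canonical map into the bidual is onto. *)
Definition reflexive_space (R : realType) (X : normedModType R) : Prop :=
  forall F, @bidual R X F -> exists x : X, forall phi, dual phi -> F phi = phi x.

Section L1.
Context d {T : measurableType d} {R : realType}.
Variable mu : {measure set T -> \bar R}.
Local Open Scope ereal_scope.

Definition L1norm (v : T -> R) : \bar R := 'N[mu]_1[EFin \o v].

Definition L0norm (v : T -> R) : \bar R := mu [set x | v x != 0%R].

Definition largest_norm (K : R) (v : T -> R) : \bar R :=
  ereal_sup [set \int[mu]_(x in A) `|v x|%:E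
            | A in [set A : set T | measurable A /\ mu A <= K%:E]].

(* LspaceType1 mu, the type of classes of integrable functions modulo a.e.
   equality, carries neither a linear structure nor a topology in the library,
   hence the pointwise a.e. formulation of linearity and the explicit use of
   L1norm. Injectivity is injectivity into the quotient. *)
Definition continuous_embedding (X : normedModType R)
    (i : X -> LspaceType1 mu) : Prop :=
  [/\ forall (a : R) (u v : X),
        i (a *: u + v)%R = (fun x => a * i u x + i v x)%R %[ae mu],
      injective i &
      exists C : R, forall u : X, L1norm (i u) <= (C * `|u|)%:E].

Definition compact_embedding (X : normedModType R)
    (i : X -> LspaceType1 mu) : Prop :=
  continuous_embedding i /\
  forall w : nat -> X, bounded_fun w ->
    exists2 k : nat -> nat, increasing_seq k &
    exists g : LspaceType1 mu,
      L1norm (fun x => i (w (k n)) x - g x)%R @[n --> \oo] --> 0.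

Definition penalty (X : normedModType R) (i : X -> LspaceType1 mu) (K : R)
    (u : X) : \bar R :=
  L1norm (i u) - largest_norm K (i u).

Definition penalized (X : normedModType R) (i : X -> LspaceType1 mu) (K : R)
    (f : X -> \bar R) (rho : R) (u : X) : \bar R :=
  f u + rho%:E * penalty i K u.

End L1.

Section extended_valued_functions.
Context {R : realType} {X : normedModType R}.
Implicit Type f : X -> \bar R.
Local Open Scope ereal_scope.

Definition proper_fun f : Prop :=
  (forall u, -oo < f u) /\ exists u, f u < +oo.

Definition convex_efun f : Prop :=
  forall (t : R) (u v : X), (0 <= t <= 1)%R ->
    f (t *: u + (1 - t) *: v)%R <= t%:E * f u + (1 - t)%:E * f v.

Definition bounded_below f : Prop := exists m : R, forall u, m%:E <= f u.

Definition coercive f : Prop :=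
  forall w : nat -> X,
    (`|w n|%R @[n --> \oo] --> +oo%R) -> f (w n) @[n --> \oo] --> +oo.

End extended_valued_functions.

Definition global_min (R : realType) (X : Type) (C : set X) (f : X -> \bar R)
    (u : X) : Prop :=
  C u /\ forall v, C v -> (f u <= f v)%E.

(* Main.v *)
(* Write P for the penalty. Comparing u_n and u_(n+1) in both penalized problems
   gives the monotonicity statements; comparing u_n with a feasible point v,
   where P v = 0, gives f(u_n) + rho_n P(u_n) <= f(v), hence P(u_n) -> 0 and,
   by coercivity, boundedness.
   For a weak accumulation point, the sublevel set {f <= f(v)} contains every
   u_n; being closed and convex it is weakly closed, by a Hahn-Banach
   separation argument. The compact embedding turns weak convergence
   into L1-convergence along a subsequence, and P is L1-Lipschitz, so P vanishes
   at the limit. Finally P u = 0 iff |u|_0 <= K: if sets A with mu A <= K carry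
   almost all of the integral of |u|, Markov's inequality on the complement of A
   shows that every superlevel set of |u| has measure at most K. *)
Require Import Defs.
From HB Require Import structures.
From mathcomp Require Import all_boot all_order all_algebra.
From mathcomp Require Import all_classical all_reals all_analysis.
From mathcomp Require Import measurable_realfun ring lra.
Import Order.TTheory GRing.Theory Num.Theory.
Import numFieldNormedType.Exports.
Local Open Scope classical_set_scope.
Local Open Scope ring_scope.
Set Implicit Arguments.
Unset Strict Implicit.
Unset Printing Implicit Defensive.

(** * Sublinear functionals and the Hahn-Banach theorem by Zorn's lemma *)

Lemma le_mul_inf (R : realType) (E : set R) (a c : R) : 0 <= a -> E !=set0 ->
  (forall z, E z -> c <= a * z) -> c <= a * inf E.
Proof.
move=> a0 E0 cE; move: a0; rewrite le_eqVlt => /predU1P[a0|a0].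
  by case: E0 => z /cE; rewrite -a0 !mul0r.
rewrite -ler_pdivrMl//; apply: lb_le_inf => // z /cE.
by rewrite -ler_pdivrMl.
Qed.

Lemma le_inf_add (R : realType) (E F : set R) (c : R) : E !=set0 -> F !=set0 ->
  (forall y z, E y -> F z -> c <= y + z) -> c <= inf E + inf F.
Proof.
move=> E0 F0 cEF; rewrite -lerBlDr; apply: lb_le_inf => // y Ey.
rewrite lerBlDr -lerBlDl; apply: lb_le_inf => // z Fz.
by rewrite lerBlDl; exact: cEF.
Qed.

Section sublinear.
Context {R : realType} {X : lmodType R}.
Implicit Types p q : X -> R.

(** Homogeneity is stated as an inequality, the form that [le_mul_inf] yields for infima;
    [sublinearZ] recovers equality. *)
Definition sublinear q :=
  (forall a x, 0 <= a -> q (a *: x) <= a * q x) /\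
  (forall x y, q (x + y) <= q x + q y).

Lemma sublinear0 q : sublinear q -> q 0 = 0.
Proof.
move=> [qZ qD]; apply/eqP; rewrite eq_le; apply/andP; split.
  by have := qZ 0 0 (lexx _); rewrite scale0r mul0r.
by have := qD 0 0; rewrite addr0 -lerBlDr subrr.
Qed.

Lemma sublinearN q x : sublinear q -> - q (- x) <= q x.
Proof.
move=> sq; rewrite lerNl -subr_ge0 opprK -(sublinear0 sq) -(subrr x) addrC.
exact: sq.2.
Qed.

Lemma sublinearZ q a x : sublinear q -> 0 <= a -> q (a *: x) = a * q x.
Proof.
move=> sq; rewrite le_eqVlt => /predU1P[<-|a0].
  by rewrite scale0r mul0r sublinear0.
apply/eqP; rewrite eq_le (sq.1 _ _ (ltW a0))/= -ler_pdivlMl//.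
rewrite -{1}[x](scalerK (lt0r_neq0 a0)); apply: sq.1.
by rewrite invr_ge0 ltW.
Qed.

(** Additivity forces [q (- x) = - q x], which extends homogeneity from nonnegative to negative
    scalars. *)
Lemma superadditive_linear q : sublinear q ->
  (forall x y, q x + q y <= q (x + y)) -> linear (q : X -> R^o).
Proof.
move=> sq supq.
have qD x y : q (x + y) = q x + q y by apply/eqP; rewrite eq_le supq sq.2.
have qN x : q (- x) = - q x.
  by apply/eqP; rewrite -addr_eq0 addrC -qD subrr sublinear0.
move=> a x y; rewrite qD; congr (_ + _).
have [a0|a0] := leP 0 a; first exact: sublinearZ.
rewrite -[a *: x]opprK -scaleNr qN sublinearZ ?oppr_ge0 ?(ltW a0)//.
by rewrite mulNr opprK.
Qed.

(** This provides the bounds of chains for Zorn's lemma. Subadditivity uses totality: of two members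
    of the chain, the smaller one is evaluated at both points. *)
Lemma inf_chain_sublinear p (A : set (X -> R)) : A !=set0 ->
  (forall q, A q -> sublinear q /\ (forall x, q x <= p x)) ->
  total_on A (fun q r => forall x, r x <= q x) ->
  sublinear (fun x => inf [set q x | q in A]) /\
  (forall q x, A q -> inf [set q x | q in A] <= q x).
Proof.
move=> [q0 Aq0] Asub Atot.
have nz x : [set q x | q in A] !=set0 by exists (q0 x), q0.
have lb q x : A q -> inf [set q x | q in A] <= q x.
  move=> Aq; apply: ge_inf; last by exists q.
  (* From [- q (- x) <= q x] and [q <= p]: a lower bound common to the whole chain. *)
  exists (- p (- x)) => _ [r Ar <-]; have [sr rp] := Asub r Ar.
  by rewrite (le_trans _ (sublinearN _ sr))// lerN2.
split=> //; split=> [a x a0|x y].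
  apply: le_mul_inf => // _ [q Aq <-].
  by rewrite (le_trans (lb _ _ Aq))// (Asub _ Aq).1.1.
apply: le_inf_add => // _ _ [q Aq <-] [r Ar <-].
have [rq|qr] := Atot _ _ Aq Ar.
  by rewrite (le_trans (lb _ _ Ar))// (le_trans ((Asub _ Ar).1.2 _ _))// lerD2r.
by rewrite (le_trans (lb _ _ Aq))// (le_trans ((Asub _ Aq).1.2 _ _))// lerD2l.
Qed.

Definition slope_inf q y x : R :=
  inf [set q (x + t *: y) - t * q y | t in [set t | 0 <= t]].

Lemma slope_inf_le q y x t : sublinear q -> 0 <= t ->
  slope_inf q y x <= q (x + t *: y) - t * q y.
Proof.
move=> sq t0; apply: ge_inf; last by exists t.
(* Writing [s *: y] as [(x + s *: y) - x], subadditivity gives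
   [s * q y <= q (x + s *: y) + q (- x)], a bound uniform in [s]. *)
exists (- q (- x)) => _ [s /= s0 <-].
rewrite lerBrDr addrC lerBlDr -sublinearZ//.
have {1}-> : s *: y = x + s *: y + - x by rewrite addrAC subrr add0r.
exact: sq.2.
Qed.

(** Competitors combine: [a * t] serves for [a *: x], and [t + t'] for [x + x']. *)
Lemma slope_inf_sublinear q y : sublinear q -> sublinear (slope_inf q y).
Proof.
move=> sq.
have nz x : [set q (x + t *: y) - t * q y | t in [set t : R | 0 <= t]] !=set0.
  by eexists; exists 0 => /=.
split=> [a x a0|x x'].
  apply: le_mul_inf => // _ [t /= t0 <-].
  rewrite (le_trans (slope_inf_le _ _ sq (mulr_ge0 a0 t0)))//.
  by rewrite -scalerA -scalerDr sublinearZ// mulrBr mulrA.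
apply: le_inf_add => // _ _ [t /= t0 <-] [t' /= t'0 <-].
rewrite (le_trans (slope_inf_le _ _ sq (addr_ge0 t0 t'0)))//.
by rewrite addrACA mulrDl opprD lerD2r scalerDl addrACA; exact: sq.2.
Qed.

(* A minimal sublinear functional q is linear: x |-> inf_t q (x + t y) - t q y
   is sublinear and below q, so minimality at t = 1 gives superadditivity. *)
Lemma sublinear_dominates_linear p : sublinear p ->
  exists2 phi : X -> R, linear (phi : X -> R^o) & forall x, phi x <= p x.
Proof.
move=> sp; pose P := [set q | sublinear q /\ (forall x, q x <= p x)].
pose rel (q r : {q | P q}) := `[< forall x, sval r x <= sval q x >].
have Pp : P p by split.
have [||A Atot|[q [sq qp]] qmin] := @ZL_preorder _ (exist _ p Pp) rel.
- by move=> q; apply/asboolP.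
- move=> q r s /asboolP qr /asboolP rs; apply/asboolP => x.
  exact: le_trans (rs x) (qr x).
- have [->|/set0P A0] := eqVneq A set0; first by exists (exist _ p Pp).
  pose B : set (X -> R) := [set sval q | q in A].
  have B0 : B !=set0 by case: A0 => q Aq; exists (sval q), q.
  have BP q : B q -> P q by move=> [[r Pr] _ <-].
  have Btot : total_on B (fun q r => forall x, r x <= q x).
    move=> _ _ [q Aq <-] [r Ar <-].
    by have [/asboolP|/asboolP] := Atot _ _ Aq Ar; [left|right].
  have [sB Ble] := inf_chain_sublinear B0 BP Btot.
  have PB : P (fun x => inf [set q x | q in B]).
    split=> // x; case: B0 => q Bq.
    by rewrite (le_trans (Ble _ _ Bq))// (BP _ Bq).2.
  exists (exist _ _ PB) => q Aq; apply/asboolP => x.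
  by apply: Ble; exists q.
exists q => //; apply: superadditive_linear => // x y.
have Py : P (slope_inf q y).
  split; first exact: slope_inf_sublinear.
  move=> z; rewrite (le_trans (slope_inf_le y z sq (lexx _)))//.
  by rewrite scale0r addr0 mul0r subr0.
have /asboolP/(_ x)/= qle : rel (exist _ _ Py) (exist _ q (conj sq qp)).
  apply: qmin; apply/asboolP => z /=.
  rewrite (le_trans (slope_inf_le y z sq (lexx _)))//.
  by rewrite scale0r addr0 mul0r subr0.
rewrite -lerBrDr (le_trans qle)// (le_trans (slope_inf_le y x sq ler01))//.
by rewrite scale1r mul1r.
Qed.

End sublinear.

(** * Separation from a convex set and weak closedness of sublevel sets *)

Section separation.
Context {R : realType} {X : normedModType R}.

Lemma bounded_linear_dual (phi : X -> R^o) (M : R) : linear phi ->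
  (forall x, `|phi x| <= M * `|x|) -> dual phi.
Proof.
move=> lphi phiM; split=> //.
pose psi := HB.pack phi (GRing.isLinear.Build _ _ _ _ phi lphi) : {linear X -> R^o}.
rewrite -[phi]/(psi : X -> R^o).
apply: (@bounded_linear_continuous _ _ _ psi); apply/linear_boundedP.
exists M; split => [|r Mr x]; first exact: num_real.
by rewrite (le_trans (phiM x))// ler_wpM2r// ltW.
Qed.

(* The linear functional comes from the sublinear
   p z = inf {|z + t (x - c)| - t e : t >= 0, c in C}, for which
   p z <= |z| (t = 0) and p (c - x) <= - e (t = 1). *)
Lemma convex_separation (C : set X) (x : X) (e : R) :
  (forall t u v, 0 <= t <= 1 -> C u -> C v -> C (t *: u + (1 - t) *: v)) ->
  (forall c, C c -> e <= `|x - c|) ->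
  exists2 phi : X -> R^o, dual phi & forall c, C c -> phi c <= phi x - e.
Proof.
move=> Cconv Ce.
have [->|/set0P [c0 Cc0]] := eqVneq C set0.
  exists (fun=> 0) => //; apply: (@bounded_linear_dual _ 0) => [a u v|u].
    by rewrite scaler0 addr0.
  by rewrite normr0 mul0r.
pose E z := [set `|z + tc.1 *: (x - tc.2)| - tc.1 * e
            | tc in [set tc : R * X | 0 <= tc.1 /\ C tc.2]].
have nz z : E z !=set0 by eexists; exists (0, c0).
have lb z t c : 0 <= t -> C c -> inf (E z) <= `|z + t *: (x - c)| - t * e.
  move=> t0 Cc; apply: ge_inf; last by exists (t, c).
  (* By the reverse triangle inequality, [s * e <= s * |x - b| <= |z + s (x - b)| + |z|]. *)
  exists (- `|z|) => _ [[s b] /= [s0 Cb] <-].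
  have : s * e <= `|s *: (x - b)| by rewrite normrZ ger0_norm// ler_wpM2l// Ce.
  have := ler_normB (z + s *: (x - b)) z; rewrite (addrC z) addrK.
  lra.
have sE : sublinear (fun z => inf (E z)).
  split=> [a z a0|z z'].
    apply: le_mul_inf => // _ [[s b] /= [s0 Cb] <-].
    rewrite (le_trans (lb _ _ _ (mulr_ge0 a0 s0) Cb))//.
    by rewrite -scalerA -scalerDr normrZ ger0_norm// mulrBr mulrA.
  apply: le_inf_add => // _ _ [[s b] /= [s0 Cb] <-] [[s' b'] /= [s'0 Cb'] <-].
  (* Convexity merges the two competitors into one of weight [s + s'], located at the weighted mean
     of [b] and [b']; if both weights vanish, any point of [C] will do. *)
  have [c Cc cE] : exists2 c, C c & (s + s') *: c = s *: b + s' *: b'.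
    have [ss0|ss0] := eqVneq (s + s') 0.
      exists b => //; have [-> ->] : s = 0 /\ s' = 0 by split; lra.
      by rewrite addr0 !scale0r addr0.
    exists ((s / (s + s')) *: b + (1 - s / (s + s')) *: b').
      have sp : 0 < s + s' by rewrite lt0r ss0 addr_ge0.
      apply: Cconv => //.
      apply/andP; split; first by rewrite divr_ge0// ltW.
      by rewrite ler_pdivrMr// mul1r lerDl.
    rewrite scalerDr !scalerA; congr (_ *: _ + _ *: _); field => //.
  rewrite (le_trans (lb _ _ _ (addr_ge0 s0 s'0) Cc))//.
  rewrite mulrDl opprD addrACA lerD2r.
  suff -> : z + z' + (s + s') *: (x - c) =
      (z + s *: (x - b)) + (z' + s' *: (x - b')) by exact: ler_normD.
  rewrite [RHS]addrACA; congr (_ + _).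
  by rewrite !scalerBr cE scalerDl opprD addrACA.
have [phi lphi phiE] := sublinear_dominates_linear sE.
have phiN z : phi z <= `|z|.
  by rewrite (le_trans (phiE z))// (le_trans (lb _ _ _ (lexx _) Cc0))//
    scale0r addr0 mul0r subr0.
have phiB y z : phi (y - z) = phi y - phi z.
  by rewrite -[y - z]addrC -scaleN1r lphi scaleN1r addrC.
exists phi.
  apply: (@bounded_linear_dual _ 1) => // z; rewrite mul1r ler_norml phiN andbT.
  rewrite lerNl; have := phiN (- z); rewrite normrN; apply: le_trans.
  have phi0 : phi 0 = 0 by rewrite -[in LHS](subrr 0) phiB subrr.
  by rewrite -(sub0r z) phiB phi0 sub0r.
move=> c Cc; rewrite -lerBlDl -phiB (le_trans (phiE _))//.
rewrite (le_trans (lb _ 1 c _ Cc))// scale1r mul1r.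
by rewrite -(opprB x c) addNr normr0 sub0r.
Qed.

(** If [c < f x], lower semicontinuity gives a ball around [x] that misses the convex set
    [{f <= c}]. The separating functional keeps a gap [e] between [phi (w n)] and [phi x], against
    weak convergence. *)
Lemma convex_lsc_weak_le (f : X -> \bar R) (w : nat -> X) (x : X) (c : R) :
  lower_semicontinuous f -> convex_efun f -> weak_cvg w x ->
  (forall n, f (w n) <= c%:E)%E -> (f x <= c%:E)%E.
Proof.
move=> flsc fconv wx fc; rewrite leNgt; apply/negP => cf.
have [V /nbhs_ballP[e /= e0 eV] Vf] := flsc _ _ cf.
have [|b /= fb|phi dphi phiC] := @convex_separation [set y | f y <= c%:E]%E x e.
- move=> t u v /andP[t0 t1] /= fu fv.
  rewrite (le_trans (fconv t u v _)) ?t0//.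
  have -> : c%:E = (t%:E * c%:E + (1 - t)%:E * c%:E)%E.
    by rewrite -!EFinM -EFinD -mulrDl addrC subrK mul1r.
  by apply: leeD; apply: lee_wpmul2l => //; rewrite lee_fin// subr_ge0.
- rewrite leNgt; apply/negP => xb; have := Vf b; rewrite ltNge fb => h.
  suff : false by []. by apply: h; apply: eV; rewrite -ball_normE.
have : phi x <= phi x - e.
  have phil := wx _ dphi.
  rewrite -[leLHS](cvg_lim _ phil)//; apply: limr_le.
    by apply/cvg_ex; exists (phi x).
  by apply: nearW => n; apply: phiC => /=.
lra.
Qed.

End separation.

(** * The largest-[K]-norm and the measure of the support *)

Section largest_norm.
Context d {T : measurableType d} {R : realType}.
Variable mu : {measure set T -> \bar R}.
Local Open Scope ereal_scope.
Implicit Types v w : T -> R.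

Lemma L1normE v : L1norm mu v = \int[mu]_x `|v x|%:E.
Proof. by rewrite /L1norm Lnorm1. Qed.

Lemma L1norm_ge0 v : 0 <= L1norm mu v.
Proof. exact: Lnorm_ge0. Qed.

Lemma L1norm_lty v : mu.-integrable setT (EFin \o v) -> L1norm mu v < +oo.
Proof. by move=> /integrableP[_]; rewrite L1normE. Qed.

Lemma Lspace_integrable (g : LspaceType1 mu) : mu.-integrable setT (EFin \o g).
Proof.
apply/integrableP; split.
  apply/measurable_EFinP => mT Y mY.
  exact: (@measurable_funPT _ _ _ _
    (repr (g : {mfun_ mu, T >-> measurableTypeR R})) mT Y mY).
by rewrite -Lnorm1; exact: Lebesgue_finite.
Qed.

Let mnormr v (A : set T) : measurable_fun setT v ->
  measurable_fun A (fun x => `|v x|%:E).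
Proof.
move=> mv; apply: measurable_funTS; apply/measurable_EFinP.
exact: measurableT_comp.
Qed.

Let measurable_superlevel v (t : R) : measurable_fun setT v ->
  measurable [set x | (t <= `|v x|)%R].
Proof.
move=> mv; rewrite -[X in measurable X]setTI.
rewrite (_ : [set x | _] = [set x | t%:E <= `|v x|%:E]).
  by apply: emeasurable_fun_c_infty => //; exact: mnormr.
by apply/seteqP; split => x /=; rewrite lee_fin.
Qed.

Lemma integral_norm_triangle v w A : measurable A ->
  measurable_fun setT v -> measurable_fun setT w ->
  \int[mu]_(x in A) `|v x|%:E <=
  \int[mu]_(x in A) `|w x|%:E + L1norm mu (fun x => v x - w x)%R.
Proof.
move=> mA mv mw.
have mvw B : measurable_fun B (fun x => `|v x - w x|%:E).
  by apply: (@mnormr (fun x => v x - w x)%R); exact: measurable_funB.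
rewrite L1normE; apply: (@le_trans _ _
    (\int[mu]_(x in A) `|w x|%:E + \int[mu]_(x in A) `|v x - w x|%:E)).
  rewrite -ge0_integralD//; try exact: mnormr; try exact: mvw.
  apply: ge0_le_integral => //; first exact: mnormr.
  - by apply: emeasurable_funD; try exact: mnormr; exact: mvw.
  - by move=> x _; rewrite -EFinD lee_fin -{1}(subrK (w x) (v x)) addrC ler_normD.
rewrite leeD2l//; apply: ge0_subset_integral => //; exact: mvw.
Qed.

Lemma largest_norm_ge0 K v : (0 <= K)%R -> 0 <= largest_norm mu K v.
Proof.
move=> K0; apply: ereal_sup_ubound; exists set0; last by rewrite integral_set0.
by split => //; rewrite measure0 lee_fin.
Qed.

Lemma largest_norm_le_L1norm K v : measurable_fun setT v ->
  largest_norm mu K v <= L1norm mu v.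
Proof.
move=> mv; apply: ge_ereal_sup => _ [A [mA _] <-].
by rewrite L1normE; apply: ge0_subset_integral => //; exact: mnormr.
Qed.

Lemma largest_norm_fin_num K v : (0 <= K)%R ->
  mu.-integrable setT (EFin \o v) -> largest_norm mu K v \is a fin_num.
Proof.
move=> K0 iv; rewrite ge0_fin_numE ?largest_norm_ge0//.
rewrite (le_lt_trans _ (L1norm_lty iv))// largest_norm_le_L1norm//.
exact/measurable_EFinP/(measurable_int _ iv).
Qed.

Lemma largest_norm_triangle K v w :
  measurable_fun setT v -> measurable_fun setT w ->
  largest_norm mu K v <=
  largest_norm mu K w + L1norm mu (fun x => v x - w x)%R.
Proof.
move=> mv mw; apply: ge_ereal_sup => _ [A [mA KA] <-].
rewrite (le_trans (integral_norm_triangle mA mv mw))// leeD2r//.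
by apply: ereal_sup_ubound; exists A.
Qed.

(** The support of [v] is itself an admissible set and carries the whole integral. *)
Lemma L0norm_le_L1norm_le K v : measurable_fun setT v ->
  L0norm mu v <= K%:E -> L1norm mu v <= largest_norm mu K v.
Proof.
move=> mv vK; apply: ereal_sup_ubound; exists [set x | v x != 0%R].
  split=> //; rewrite -[X in measurable X]setTI.
  rewrite (_ : [set x | _] = [set x | (v x)%:E != 0]).
    apply: emeasurable_neq => //; exact/measurable_EFinP.
  by apply/seteqP; split => x /=; rewrite eqe.
rewrite L1normE integral_mkcond; apply: eq_integral => x _.
rewrite patchE; case: ifPn => // /negP vx.
have [->|v0] := eqVneq (v x) 0%R; first by rewrite normr0.
by exfalso; apply: vx; rewrite inE.
Qed.

(* Given A with mu A <= K capturing all but [t * e] of the integral of |v|,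
   Markov's inequality on the complement of A bounds mu {|v| >= t} by K + e. *)
Lemma superlevel_measure_le K v (t : R) : (0 <= K)%R -> (0 < t)%R ->
  mu.-integrable setT (EFin \o v) -> L1norm mu v <= largest_norm mu K v ->
  mu [set x | (t <= `|v x|)%R] <= K%:E.
Proof.
move=> K0 t0 iv vK; have mv : measurable_fun setT v.
  exact/measurable_EFinP/(measurable_int _ iv).
have mE := measurable_superlevel t mv.
apply/lee_addgt0Pr => e e0.
have [_ [A [mA KA] <-] ltA] :=
  ub_ereal_sup_adherent (mulr_gt0 t0 e0) (largest_norm_fin_num K0 iv).
have Afin : \int[mu]_(x in A) `|v x|%:E \is a fin_num.
  rewrite ge0_fin_numE ?integral_ge0//.
  rewrite (le_lt_trans _ (L1norm_lty iv))// L1normE.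
  by apply: ge0_subset_integral => //; exact: mnormr.
have CA : \int[mu]_(x in ~` A) `|v x|%:E <= (t * e)%:E.
  have tot : L1norm mu v =
      \int[mu]_(x in A) `|v x|%:E + \int[mu]_(x in ~` A) `|v x|%:E.
    rewrite L1normE -(setUv A) ge0_integral_setU//=.
    + exact: measurableC.
    + by rewrite setUv; exact: mnormr.
    + exact/disj_setPCl.
  rewrite -(leeD2lE _ _ Afin) -tot -leeBlDr// (le_trans _ (ltW ltA))//.
  by rewrite leeB.
have markov : t%:E * mu (~` A `&` [set x | (t <= `|v x|)%R]) <= (t * e)%:E.
  apply: le_trans CA.
  rewrite (_ : [set x | _] = [set x | t%:E <= `|(EFin \o v) x|]); last first.
    by apply/seteqP; split => x /=; rewrite lee_fin.
  apply: (@le_integral_comp_abse _ _ _ mu _ (measurableC mA) (EFin \o v) t id) => //.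
  exact/measurable_funTS/measurable_EFinP.
move: markov; rewrite EFinM lee_pmul2l// => markov.
set E := [set x | _] in mE markov *.
rewrite -(setUIDK E A) (le_trans (measureU2 _ _ _))//; [..|apply: leeD].
- exact: measurableI.
- exact: measurableD.
- by rewrite (le_trans _ KA)// le_measure ?inE//; exact: measurableI.
- by rewrite setDE setIC.
Qed.

(** The support is the increasing union of the superlevel sets at heights [1 / (n + 1)], so
    continuity from below transfers the bound. *)
Lemma L1norm_le_L0norm_le K v : (0 <= K)%R ->
  mu.-integrable setT (EFin \o v) -> L1norm mu v <= largest_norm mu K v ->
  L0norm mu v <= K%:E.
Proof.
move=> K0 iv vK; pose F n := [set x | (n.+1%:R^-1 <= `|v x|)%R].
have mv : measurable_fun setT v by exact/measurable_EFinP/(measurable_int _ iv).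
have mF n : measurable (F n) by exact: measurable_superlevel.
have -> : L0norm mu v = mu (\bigcup_n F n).
  congr (mu _); apply/seteqP; split => [x /= vx|x [n _]]; last first.
    by rewrite /F/= -normr_gt0; apply: lt_le_trans; rewrite invr_gt0.
  move: vx; rewrite -normr_gt0 => /ltr_add_invr[n]; rewrite add0r => vn.
  by exists n => //; exact: ltW.
have ndF : nondecreasing_seq F.
  move=> n m nm; apply/subsetPset => x; rewrite /F/=; apply: le_trans.
  by rewrite lef_pV2 ?posrE// ler_nat.
have cF := nondecreasing_cvg_mu (mu := mu) mF (bigcup_measurable (fun n _ => mF n)) ndF.
rewrite -(cvg_lim _ cF)//; apply: lime_le; first by apply/cvg_ex; eexists; exact: cF.
by apply: nearW => n /=; apply: superlevel_measure_le.
Qed.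

End largest_norm.

(** * Finiteness, sign, zeros and Lipschitz continuity of the penalty *)

Section penalty.
Context d {T : measurableType d} {R : realType}.
Variable mu : {measure set T -> \bar R}.
Local Open Scope ereal_scope.
Implicit Types v w : T -> R.

Lemma L1norm_subC v w :
  L1norm mu (fun x => v x - w x)%R = L1norm mu (fun x => w x - v x)%R.
Proof. by rewrite !L1normE; apply: eq_integral => x _; rewrite distrC. Qed.

Lemma L1norm_fin_num v : mu.-integrable setT (EFin \o v) ->
  L1norm mu v \is a fin_num.
Proof. by move=> iv; rewrite ge0_fin_numE ?L1norm_ge0 ?L1norm_lty. Qed.

(** Each of the two norms is 1-Lipschitz for the L1 distance, whence the factor 2. Integrability
    makes all terms finite and reduces the claim to real arithmetic. *)
Lemma L1norm_sub_largest_norm_le K v w : (0 <= K)%R ->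
  mu.-integrable setT (EFin \o v) -> mu.-integrable setT (EFin \o w) ->
  L1norm mu v - largest_norm mu K v <= L1norm mu w - largest_norm mu K w +
    2%:E * L1norm mu (fun x => v x - w x)%R.
Proof.
move=> K0 iv iw.
have mv : measurable_fun setT v by exact/measurable_EFinP/(measurable_int _ iv).
have mw : measurable_fun setT w by exact/measurable_EFinP/(measurable_int _ iw).
have := integral_norm_triangle mu measurableT mv mw; rewrite -!L1normE.
have := largest_norm_triangle mu K mw mv; rewrite (L1norm_subC w).
have ivw : mu.-integrable setT (EFin \o (fun x => v x - w x)%R).
  exact: (integrableB measurableT iv iw).
rewrite -(fineK (L1norm_fin_num iv)) -(fineK (L1norm_fin_num iw)).
rewrite -(fineK (L1norm_fin_num ivw)).
rewrite -(fineK (largest_norm_fin_num K0 iv)).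
rewrite -(fineK (largest_norm_fin_num K0 iw)).
rewrite -!EFinN -EFinM -!EFinD !lee_fin; lra.
Qed.

Context {X : normedModType R} (i : X -> LspaceType1 mu) (K : R).
Hypothesis K0 : (0 <= K)%R.

Lemma penalty_fin_num u : penalty i K u \is a fin_num.
Proof.
have iu := Lspace_integrable (i u).
by rewrite fin_numB L1norm_fin_num// largest_norm_fin_num.
Qed.

Lemma penalty_ge0 u : 0 <= penalty i K u.
Proof.
have iu := Lspace_integrable (i u).
rewrite sube_ge0 ?largest_norm_fin_num// largest_norm_le_L1norm//.
exact/measurable_EFinP/(measurable_int _ iu).
Qed.

Lemma penalty_eq0 u : penalty i K u = 0 <-> L0norm mu (i u) <= K%:E.
Proof.
have iu := Lspace_integrable (i u).
have le0 : (penalty i K u <= 0) = (L1norm mu (i u) <= largest_norm mu K (i u)).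
  by rewrite /penalty leeBlDr ?add0e// largest_norm_fin_num.
split => [pu0|uK].
  by apply: L1norm_le_L0norm_le => //; rewrite -le0 pu0.
apply/eqP; rewrite eq_le penalty_ge0 andbT le0 L0norm_le_L1norm_le//.
exact/measurable_EFinP/(measurable_int _ iu).
Qed.

End penalty.

(** * Weak limits in [X] and strong limits in L1 *)

Section weak_limit.
Context d {T : measurableType d} {R : realType}.
Variable mu : {measure set T -> \bar R}.
Context {X : normedModType R} (i : X -> LspaceType1 mu).
Hypothesis ci : continuous_embedding i.

Lemma normr_Rintegral_le_L1norm (v : T -> R) A : measurable A ->
  mu.-integrable setT (EFin \o v) ->
  (`|\int[mu]_(x in A) v x|%:E <= L1norm mu v)%E.
Proof.
move=> mA iv.
have iA : mu.-integrable A (EFin \o v) by exact: integrableS iv.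
have mv := measurable_int _ iv.
rewrite EFin_normr_Rintegral//.
apply: (le_trans (le_abse_integral mu mA (measurable_int _ iA))).
rewrite L1normE; apply: ge0_subset_integral => //.
exact: measurableT_comp.
Qed.

(** These functionals test weak convergence. Linearity of [i] up to null sets is enough under an
    integral, and the embedding constant bounds the functional. *)
Lemma embedding_integral_dual A : measurable A ->
  dual (fun u : X => \int[mu]_(x in A) i u x : R^o).
Proof.
move=> mA; have [ilin _ [M iM]] := ci.
have ii u := Lspace_integrable (i u).
have iA u : mu.-integrable A (EFin \o i u) by exact: integrableS (ii u).
apply: (@bounded_linear_dual _ _ _ M) => [a u v|u].
  rewrite [RHS](_ : _ = a * \int[mu]_(x in A) i u x + \int[mu]_(x in A) i v x)//.
  rewrite -RintegralZl// -RintegralD//; last first.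
    exact: (integrableZl mA a (iA u)).
  rewrite /Rintegral; congr fine; apply: ae_eq_integral => //.
  - exact: measurable_int (iA _).
  - apply: (@measurable_int _ _ _ mu).
    exact: (integrableD mA (integrableZl mA a (iA u)) (iA v)).
  - have := ilin a u v; apply: filterS => x /=.
    by move=> /(_ I) -> _.
rewrite -lee_fin (le_trans _ (iM u))//.
exact: normr_Rintegral_le_L1norm.
Qed.

(* The weak limit and the strong L1 limit have the same integral over every
   measurable set, since u |-> int_A i u is weakly continuous. *)
Lemma weak_L1_limit (w : nat -> X) (x : X) (g : LspaceType1 mu) :
  weak_cvg w x ->
  (L1norm mu (fun y => i (w n) y - g y)%R @[n --> \oo] --> 0)%E ->
  (L1norm mu (fun y => i (w n) y - i x y)%R @[n --> \oo] --> 0)%E.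
Proof.
move=> wx wg.
have ii u := Lspace_integrable (i u); have ig := Lspace_integrable g.
have mg := measurable_int _ ig.
have xg : ae_eq mu setT (EFin \o i x) (EFin \o g).
  apply: integral_ae_eq => // A _ mA.
  have iA v : mu.-integrable setT (EFin \o v) -> mu.-integrable A (EFin \o v).
    by move=> iv; exact: integrableS iv.
  rewrite -[LHS]fineK ?integrable_fin_num//; last exact: iA.
  rewrite -[RHS]fineK ?integrable_fin_num//; last exact: iA.
  congr EFin.
  have xlim := wx _ (embedding_integral_dual mA).
  (* The integrals of [i (w n)] over [A] converge to that of [i x] by weak convergence; it remains
     to see that they also converge to that of [g]. *)
  apply: (cvg_unique _ xlim) => //.
  apply/cvgrPdist_le => e e0.
  have e0' : (0 < e%:E)%E by rewrite lte_fin.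
  have : \forall n \near \oo,
      (L1norm mu (fun y => i (w n) y - g y)%R < e%:E)%E.
    exact: (wg _ (open_ereal_lt' e0')).
  apply: filterS => n /= Hn.
  rewrite distrC -lee_fin (le_trans _ (ltW Hn))//.
  rewrite -RintegralB//; try exact: iA.
  apply: normr_Rintegral_le_L1norm => //.
  exact: (integrableB measurableT (ii _) ig).
suff E : (fun n => L1norm mu (fun y => i (w n) y - i x y)%R) =
    (fun n => L1norm mu (fun y => i (w n) y - g y)%R) by rewrite E.
apply/funext => n; rewrite !L1normE; apply: ae_eq_integral => //.
- have /integrable_abse/measurable_int := integrableB measurableT (ii (w n)) (ii x).
  exact.
- have /integrable_abse/measurable_int := integrableB measurableT (ii (w n)) ig.
  exact.
- by apply: filterS xg => y /= /(_ I) [->].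
Qed.

End weak_limit.

Lemma increasing_seq_cvgny (k : nat -> nat) :
  increasing_seq k -> k n @[n --> \oo] --> \oo.
Proof.
move=> /increasing_seqP kincr; apply/cvgnyPge => A; exists A => // n /= An.
apply: (leq_trans An); elim: n {An} => // n IHn.
exact: leq_ltn_trans IHn (kincr n).
Qed.

(** Along a further subsequence [w] converges in L1, necessarily to [i x]; the Lipschitz bound then
    squeezes the penalty of [x] below a null sequence. *)
Lemma penalty_weak_limit_eq0 d (T : measurableType d) (R : realType)
    (mu : {measure set T -> \bar R}) (X : normedModType R)
    (i : X -> LspaceType1 mu) (K : R) (w : nat -> X) (x : X) :
  0 <= K -> compact_embedding i -> bounded_fun w -> weak_cvg w x ->
  penalty i K (w n) @[n --> \oo] --> 0%E -> penalty i K x = 0%E.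
Proof.
move=> K0 [ci compi] bw wx Pw.
have [k kincr [g wg]] := compi _ bw.
have koo := increasing_seq_cvgny kincr.
have wkx : weak_cvg (w \o k) x.
  move=> phi dphi; have := cvg_comp _ _ koo (wx _ dphi); exact.
have Lwx := weak_L1_limit ci wkx wg.
apply/eqP; rewrite eq_le penalty_ge0// andbT.
have : (penalty i K (w (k n)) +
    2%:E * L1norm mu (fun y => i (w (k n)) y - i x y)%R)%E
    @[n --> \oo] --> 0%E.
  rewrite -[X in _ --> X](_ : 0 + 2%:E * 0 = 0)%E; last by rewrite mule0 adde0.
  apply: cvgeD; first by rewrite mule0.
    exact: (cvg_comp _ _ koo Pw).
  exact: cvgeZl.
move=> lim0; apply: (cvge_to_ge lim0); apply: nearW => n.
rewrite L1norm_subC; apply: L1norm_sub_largest_norm_le => //;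
  exact: Lspace_integrable.
Qed.

(** Otherwise one can choose indices [N m] with [m <= |u (N m)|]. Coercivity applies to any sequence
    with norms tending to infinity, so [N] may be arbitrary, and [f] would exceed [c]. *)
Lemma coercive_bounded_sublevel (R : realType) (X : normedModType R)
    (f : X -> \bar R) (c : R) (u : nat -> X) :
  coercive f -> (forall n, f (u n) <= c%:E)%E -> bounded_fun u.
Proof.
move=> fcoer fc; apply: contrapT => ubnd.
have /choice[N Nu] : forall m : nat, exists n, m%:R <= `|u n|.
  move=> m; apply: contrapT => /forallNP um; apply: ubnd.
  exists m%:R; split => [|M mM n _ /=]; first exact: num_real.
  by rewrite (le_trans _ (ltW mM))// leNgt; apply/negP => /ltW; exact: um.
have /fcoer/cvgey_gt/(_ c)[n _ /(_ n (leqnn n))/=] :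
    `|u (N n)| @[n --> \oo] --> +oo.
  apply/cvgryPge => A; near=> n.
  by rewrite (le_trans _ (Nu n))//; near: n; exact: nbhs_infty_ger.
by rewrite ltNge fc.
Unshelve. all: by end_near. Qed.

(** * Monotonicity, convergence and optimality for the penalty method *)

Unset Implicit Arguments.

Theorem theorem5p4 (d : measure_display) (T : measurableType d) (R : realType)
  (mu : {sigma_finite_measure set T -> \bar R})
  (K : R) (K_gt0 : 0 < K) (K_lt : (K%:E < mu setT)%E)
  (X : completeNormedModType R) (X_refl : reflexive_space X)
  (i : X -> LspaceType1 mu) (i_cpt : compact_embedding i)
  (f : X -> \bar R) (f_proper : proper_fun f) (f_lsc : lower_semicontinuous f)
  (f_convex : convex_efun f) (f_below : bounded_below f)
  (f_coercive : coercive f)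
  (f_feasible : exists u0 : X, (f u0 < +oo)%E /\ (L0norm mu (i u0) <= K%:E)%E)
  (rho : nat -> R) (rho_gt0 : forall n, 0 < rho n)
  (rho_incr : increasing_seq rho) (rho_infty : rho n @[n --> \oo] --> +oo)
  (u : nat -> X)
  (u_min : forall n, global_min setT (penalized i K f (rho n)) (u n)) :
  (forall n, (penalized i K f (rho n) (u n) <=
              penalized i K f (rho n.+1) (u n.+1))%E) /\
  (forall n, (penalty i K (u n.+1) <= penalty i K (u n))%E) /\
  (forall n, (f (u n) <= f (u n.+1))%E) /\
  (penalty i K (u n) @[n --> \oo] --> 0%E) /\
  bounded_fun u /\
  (forall ubar : X, weak_accumulation_point u ubar ->
     global_min [set v : X | (L0norm mu (i v) <= K%:E)%E] f ubar).
Proof.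
have K0 := ltW K_gt0.
have [u0 [fu0 u0K]] := f_feasible.
have le_feasible n v : (L0norm mu (i v) <= K%:E)%E ->
    (penalized i K f (rho n) (u n) <= f v)%E.
  move=> /(penalty_eq0 i K0) vK; rewrite (le_trans ((u_min n).2 v I))//.
  by rewrite /penalized vK mule0 adde0.
have rpen_ge0 n v : (0 <= (rho n)%:E * penalty i K v)%E.
  by rewrite mule_ge0 ?penalty_ge0// lee_fin ltW.
have f_le_feasible n v : (L0norm mu (i v) <= K%:E)%E -> (f (u n) <= f v)%E.
  by move=> /(le_feasible n); apply: le_trans; rewrite leeDl.
have fufin n : f (u n) \is a fin_num.
  by rewrite fin_numElt f_proper.1 (le_lt_trans (f_le_feasible n _ u0K)).
have fu0fin : f u0 \is a fin_num by rewrite fin_numElt f_proper.1.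
(* All values at the iterates are finite, so minimality becomes the family [ap_le] of real
   inequalities, linear in [a] and [p]. *)
pose a n := fine (f (u n)); pose p n := fine (penalty i K (u n)).
have aE n : f (u n) = (a n)%:E by rewrite fineK.
have pE n : penalty i K (u n) = (p n)%:E by rewrite fineK// penalty_fin_num.
have apE m n : penalized i K f (rho m) (u n) = (a n + rho m * p n)%:E.
  by rewrite /penalized aE pE.
have p_ge0 n : 0 <= p n by rewrite -lee_fin -pE penalty_ge0.
have ap_le m n : a m + rho m * p m <= a n + rho m * p n.
  by rewrite -lee_fin -!apE; exact: (u_min m).2.
have rho_lt n : rho n < rho n.+1 by apply/increasing_seqP: n.
(* Adding [ap_le] for [(n, n.+1)] and [(n.+1, n)] cancels [a] and leaves
   [(rho n.+1 - rho n) * (p n.+1 - p n) <= 0]. *)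
have p_noninc n : p n.+1 <= p n.
  rewrite -(ler_pM2l (_ : 0 < rho n.+1 - rho n)) ?subr_gt0//.
  have := ap_le n n.+1; have := ap_le n.+1 n; lra.
have Pu0 : penalty i K (u n) @[n --> \oo] --> 0%E.
  have [m fm] := f_below.
  (* With [m] a lower bound of [f], [m + rho n * p n <= a n + rho n * p n <= f u0]. *)
  have p_le n : p n <= (fine (f u0) - m) * (rho n)^-1.
    rewrite ler_pdivlMr//.
    have := le_feasible n _ u0K; rewrite apE -[f u0]fineK// lee_fin.
    have := fm (u n); rewrite aE lee_fin; lra.
  under eq_fun do rewrite pE.
  apply: cvg_EFin; first exact: nearW.
  apply: (@squeeze_cvgr _ _ _ _ (fun=> 0) (fun n => (fine (f u0) - m) * (rho n)^-1)).
  - by apply: nearW => n; rewrite p_ge0 p_le.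
  - exact: cvg_cst.
  - rewrite -(mulr0 (fine (f u0) - m)); apply: cvgMr.
    by apply/gtr0_cvgV0 => //; apply: nearW.
have bu : bounded_fun u.
  apply: (@coercive_bounded_sublevel _ _ f (fine (f u0)) u f_coercive) => n.
  by rewrite fineK//; exact: f_le_feasible.
split; [|split; [|split; [|split; [|split]]]] => //.
(* Compare with [u n.+1] at parameter [rho n], then raise the parameter, using [0 <= p n.+1]. *)
- move=> n; rewrite !apE lee_fin (le_trans (ap_le n n.+1))// lerD2l.
  by rewrite ler_wpM2r// ltW.
- by move=> n; rewrite !pE lee_fin.
- move=> n; rewrite !aE lee_fin.
  have := ap_le n n.+1.
  have : rho n * p n.+1 <= rho n * p n by rewrite ler_pM2l.
  lra.
move=> ubar [k kincr wk].
have koo := increasing_seq_cvgny kincr.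
split=> /=.
  apply/(penalty_eq0 i K0)/(penalty_weak_limit_eq0 K0 i_cpt _ wk).
    by have [M [Mreal uM]] := bu; exists M; split => // r /uM ur n _; exact: ur.
  exact: (cvg_comp _ _ koo Pu0).
(* Only a finite value [c] of [f v] needs work: every iterate lies in [{f <= c}], hence so does the
   weak limit. *)
move=> v /= vK; case fv: (f v) => [c| |]; last 2 first.
- by rewrite leey.
- by have := f_proper.1 v; rewrite fv.
apply: (convex_lsc_weak_le f_lsc f_convex wk) => n /=.
by rewrite -fv f_le_feasible.
Qed.
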